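(* Let $U$ be an open neighborhood of the origin in $\mathbb{R}^n$ and let $f\in C^\infty(U)$. Then, as $t\to0$, we have $$f(t\cdot x)\simeq\sum_{\ell\ge0}t^\ell f^{[\ell]}(x)\qquad\text{in }C^\infty(U),$$ where $f^{[\ell]}(x)=\sum_{\langle\alpha\rangle=\ell}\frac{1}{\alpha!}\partial_x^\alpha f(0)x^\alpha$ is a polynomial which is homogeneous of degree $\ell$ with respect to the dilations $x\mapsto t\cdot x$.
   Context: $(w_1,\ldots,w_n)$ is the weight sequence of an $n$-dimensional Carnot manifold of step $r$; all that matters here is that it is a non-decreasing sequence of integers in $\{1,\ldots,r\}$. Set $\delta_t(x)=t\cdot x=(t^{w_1}x_1,\ldots,t^{w_n}x_n)$ for $t\in\mathbb{R}$, $x\in\mathbb{R}^n$, and $\langle\alpha\rangle=w_1\alpha_1+\cdots+w_n\alpha_n$ for $\alpha\in\mathbb{N}_0^n$. A function $g$ on $\mathbb{R}^n$ is homogeneous of degree $\ell$ if $g(t\cdot x)=t^\ell g(x)$ for all $x\in\mathbb{R}^n$, $t\in\mathbb{R}$. For a compact $K\subset U$ and $\alpha\in\mathbb{N}_0^n$ let $p_{K,\alpha}(g)=\sup_{x\in K}|\partial^\alpha g(x)|$, which makes sense for $g$ smooth near $K$; for $t$ small enough $f\circ\delta_t$ is defined and smooth near $K$. The asymptotic expansion in $C^\infty(U)$ means that, for every integer $N\ge 0$, every compact $K\subset U$ and every $\alpha\in\mathbb{N}_0^n$, $$p_{K,\alpha}\Big(f\circ\delta_t-\sum_{\ell<N}t^\ell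 f^{[\ell]}\Big)=\operatorname{O}(t^N)\qquad\text{as }t\to0.$$ *)

(* Defs.v *)
From HB Require Import structures.
From mathcomp Require Import all_boot all_order all_algebra.
From mathcomp Require Import all_classical all_reals all_analysis.
From mathcomp Require mpoly.

Set Implicit Arguments.
Unset Strict Implicit.
Unset Printing Implicit Defensive.

Import Order.TTheory GRing.Theory Num.Theory.
Import numFieldNormedType.Exports.

Local Open Scope classical_set_scope.
Local Open Scope ring_scope.

Section Defs.
Variables (R : realType) (n : nat).

Implicit Types (w : 'I_n -> nat) (a : {ffun 'I_n -> nat}).
Implicit Types (x : 'rV[R]_n) (f g : 'rV[R]_n -> R) (U K : set 'rV[R]_n).

Definition dil w (t : R) x : 'rV[R]_n := \row_i (t ^+ w i * x 0 i).

Definition wdeg w a : nat := (\sum_i w i * a i)%N.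

Definition mfact a : nat := (\prod_i (a i)`!)%N.

Definition monom a x : R := \prod_i x 0 i ^+ a i.

Definition pderive (i : 'I_n) g : 'rV[R]_n -> R :=
  fun x => 'D_(delta_mx 0 i) g x.

Definition pderives (s : seq 'I_n) g : 'rV[R]_n -> R := foldr pderive g s.

Definition mpderive a g : 'rV[R]_n -> R :=
  foldr (fun i h => iter (a i) (pderive i) h) g (enum 'I_n).

(* C^oo(U) for U open: the iterated partial derivatives of all orders, taken in
   any order, exist and are continuous on U. Functions are total, but when U is
   open this only depends on the values of g on U. *)
Definition smooth_on U g : Prop :=
  forall (s : seq 'I_n) x, U x ->
    {for x, continuous (pderives s g)} /\
    forall i : 'I_n, derivable (pderives s g) x (delta_mx 0 i).

(* The supremum is taken in \bar R because the real-valued sup is 0 on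
   unbounded sets. *)
Definition seminorm K a g : \bar R :=
  ereal_sup [set (`|mpderive a g x|)%:E | x in K].

(* F t ~ \sum_l t ^ l c_l in C^oo(U) as t -> 0, where F t is a function on D t.
   The first conjunct says that the seminorm makes sense, i.e. that F t is
   defined and smooth near K. *)
Definition smooth_asymptotic U (D : R -> set 'rV[R]_n)
    (F : R -> 'rV[R]_n -> R) (c : nat -> 'rV[R]_n -> R) : Prop :=
  forall (N : nat) K a, compact K -> K `<=` U ->
    exists C : R, \forall t \near (0 : R),
      (exists V : set 'rV[R]_n,
          [/\ open V, K `<=` V, V `<=` D t & smooth_on V (F t)]) /\
      (seminorm K a (fun x => F t x - \sum_(l < N) t ^+ l * c l x)%R
         <= (C * `|t ^+ N|)%:E)%E.

(* The index set is finite when all the weights are positive. *)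
Definition taylor_part w f (l : nat) x : R :=
  \sum_(a \in [set a : {ffun 'I_n -> nat} | wdeg w a = l])
     (mfact a)%:R^-1 * mpderive a f 0 * monom a x.

Definition polynomial_fun g : Prop :=
  exists p : mpoly.mpoly n R, forall x, g x = mpoly.meval (x 0) p.

Definition homogeneous w (l : nat) g : Prop :=
  forall (t : R) x, g (dil w t x) = t ^+ l * g x.

End Defs.

(* Main.v *)
(* Let R_M f (t, x) = f (t . x) - \sum_(l < M) t ^ l f^[l] (x). By the chain
   rule and the identity d_i f^[l] = (d_i f)^[l - w_i] (where the symmetry of the
   second derivatives enters),
     d_i (R_M f) = t ^ w_i * R_(M - w_i) (d_i f),
   with truncated subtraction M - w_i. Hence d^a (R_N f) is t ^ <a> times
   R_(N - <a>) (d^a f), and only uniform bounds on bounded sets of x are needed.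
   Since R_M f (t, 0) = 0 for M > 0, these follow for all smooth f by strong
   induction on M, from the mean value theorem along the coordinate axes; no
   Taylor formula in several variables is involved. *)
Require Import Defs.
From mathcomp Require Import all_boot all_order all_algebra.
From mathcomp Require Import all_classical all_reals all_analysis.
From mathcomp Require mpoly.
Import Order.TTheory GRing.Theory Num.Theory.
Import numFieldNormedType.Exports.
Local Open Scope classical_set_scope.
Local Open Scope ring_scope.

Set Implicit Arguments.
Unset Strict Implicit.
Unset Printing Implicit Defensive.

(** * Directional derivatives as one-variable derivatives *)

Section DirectionalDerivative.
Variables (R : realType) (V : normedModType R).

(** Both difference quotients are the same function of the increment, so one-variable calculus
    applies to directional derivatives. *)
Lemma is_derive_line (f : V -> R) x v df :
  is_derive x v f df <-> is_derive (0 : R) 1 (fun h : R => f (h *: v + x)) df.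
Proof.
have E : (fun h => h^-1 *: ((f \o shift x) (h *: v) - f x)) =
    (fun h => h^-1 *: (((fun h : R => f (h *: v + x)) \o shift 0) (h *: 1) -
       (fun h : R => f (h *: v + x)) 0)).
  by apply/funext => h /=; rewrite addr0 scale0r add0r [_%:A]mulr1.
by split=> -[]; rewrite /derivable /derive => ? ?; split;
  rewrite /derivable /derive ?E // -E.
Qed.

End DirectionalDerivative.

(** * Mean value theorem along lines and symmetry of second derivatives *)

Section MeanValue.
Variables (R : realType) (V : normedModType R).

Lemma is_derive_dirZ (f : V -> R) x v (c : R) df :
  is_derive x v f df -> is_derive x (c *: v) f (c * df).
Proof.
move=> /is_derive_line fx; apply/is_derive_line.
rewrite (_ : (fun _ => _) = (fun h => f (h *: v + x)) \o (fun h : R => c * h)).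
  rewrite mulrC; apply: is_derive1_comp; first by rewrite mulr0.
  by apply: is_derive_eq; rewrite [_%:A]mulr1.
by apply/funext => h /=; rewrite scalerA mulrC.
Qed.

Lemma is_derive_on_line (f : V -> R) y v (s : R) :
  derivable f (y + s *: v) v ->
  is_derive s 1 (fun s : R => f (y + s *: v)) ('D_v f (y + s *: v)).
Proof.
move=> /derivableP/is_derive_line fs; apply/is_derive_line.
rewrite (_ : (fun _ => _) = (fun h => f (h *: v + (y + s *: v)))) //.
by apply/funext => h; rewrite [_%:A]mulr1 scalerDl addrCA.
Qed.

Lemma MVT_line (f : V -> R) y v :
  (forall s : R, 0 <= s <= 1 -> derivable f (y + s *: v) v) ->
  exists2 s, 0 <= s <= 1 & f (y + v) - f y = 'D_v f (y + s *: v).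
Proof.
move=> fd.
have der (s : R) : s \in `[0, 1] ->
    is_derive s 1 (fun s : R => f (y + s *: v)) ('D_v f (y + s *: v)).
  by rewrite in_itv /= => /fd; exact: is_derive_on_line.
set F := fun s : R => f (y + s *: v).
have cF : {within `[0, 1], continuous F}.
  by apply: derivable_within_continuous => s /der[].
have dF (s : R) : s \in `]0, 1[ -> is_derive s 1 F ('D_v f (y + s *: v)).
  by move=> /subset_itv_oo_cc; exact: der.
have [s] := MVT_segment (ler01 : (0 : R) <= 1) dF cF.
rewrite /F in_itv scale0r scale1r addr0 subr0 mulr1 => /=; exists s => //.
Qed.

Lemma derive_shift_arg (f : V -> R) z x v :
  derivable f (x + z) v -> is_derive x v (fun y => f (y + z)) ('D_v f (x + z)).
Proof.
move=> /derivableP/is_derive_line fx; apply/is_derive_line.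
by under eq_fun do rewrite -addrA.
Qed.

Lemma MVT_lineZ (f : V -> R) y v (h : R) :
  (forall s : R, 0 <= s <= 1 -> derivable f (y + (s * h) *: v) v) ->
  exists2 s, 0 <= s <= 1 & f (y + h *: v) - f y = h * 'D_v f (y + (s * h) *: v).
Proof.
move=> fd.
have dh (s : R) : 0 <= s <= 1 ->
    is_derive (y + s *: (h *: v)) (h *: v) f (h * 'D_v f (y + (s * h) *: v)).
  by move=> /fd fs; apply: is_derive_dirZ; rewrite scalerA; exact: derivableP.
have [s /dh[//]|s s01 ->] := @MVT_line f y (h *: v); exists s => //.
by have /dh[_ ->] := s01.
Qed.

(** The mean value theorem is applied twice: in direction [u] to the increment [g] of [f] by
    [h *: v], then in direction [v] to ['D_u f]. *)
Lemma second_difference (f : V -> R) x u v (h : R) :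
  (forall s t : R, 0 <= s <= 1 -> 0 <= t <= 1 ->
     derivable f (x + (s * h) *: u + (t * h) *: v) u /\
     derivable ('D_u f) (x + (s * h) *: u + (t * h) *: v) v) ->
  exists s t : R, [/\ 0 <= s <= 1, 0 <= t <= 1 &
    f (x + h *: u + h *: v) - f (x + h *: u) - (f (x + h *: v) - f x) =
    h * (h * 'D_v ('D_u f) (x + (s * h) *: u + (t * h) *: v))].
Proof.
move=> fd; pose g y := f (y + h *: v) - f y.
have dg (s : R) : 0 <= s <= 1 -> is_derive (x + (s * h) *: u) u g
    ('D_u f (x + (s * h) *: u + h *: v) - 'D_u f (x + (s * h) *: u)).
  (* The two terms of [g] are covered by the hypothesis at [t = 1] and at [t = 0]. *)
  move=> s01; apply: is_deriveB.
    apply: derive_shift_arg.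
    by have [] := fd s 1 s01; rewrite ?mul1r // ler01 lexx.
  have [] := fd s 0 s01; rewrite ?lexx ?ler01 //.
  by rewrite mul0r scale0r addr0 => /derivableP.
have [s /dg[//]|s s01] := @MVT_lineZ g x u h.
have [_ ->] := dg _ s01; rewrite /g => ->.
have [t t01|t t01 ->] := @MVT_lineZ ('D_u f) (x + (s * h) *: u) v h.
  by have [] := fd s t s01 t01.
by exists s, t.
Qed.

(** Schwarz's theorem. The second difference of [f] is symmetric in [u] and [v], so it expresses
    both mixed derivatives at points near [z], where continuity ties them to their values at [z]. *)
Lemma derive_swap (f : V -> R) z u v :
  (\forall x \near z, derivable f x u) ->
  (\forall x \near z, derivable f x v) ->
  (\forall x \near z, derivable ('D_u f) x v) ->
  (\forall x \near z, derivable ('D_v f) x u) ->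
  {for z, continuous ('D_v ('D_u f))} -> {for z, continuous ('D_u ('D_v f))} ->
  'D_v ('D_u f) z = 'D_u ('D_v f) z.
Proof.
move=> fu fv fuv fvu cuv cvu.
apply/eqP; rewrite -subr_eq0 -normr_le0; apply/ler_addgt0Pr => e e0.
have e2 : 0 < e / 2 by rewrite divr_gt0.
have /nbhs_ballP[r /= r0 rP] : \forall x \near z,
    [/\ derivable f x u /\ derivable ('D_u f) x v,
        derivable f x v /\ derivable ('D_v f) x u,
        `|'D_v ('D_u f) z - 'D_v ('D_u f) x| < e / 2 &
        `|'D_u ('D_v f) z - 'D_u ('D_v f) x| < e / 2].
  move/cvgrPdist_lt: cuv => /(_ _ e2) cuv.
  move/cvgrPdist_lt: cvu => /(_ _ e2) cvu.
  apply: filterS (filterI (filterI (filterI fu fuv) (filterI fv fvu))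
    (filterI cuv cvu)) => y.
  case=> [[[a b] [c d]] [e3 e4]].
  refine (And4 (conj a b) (conj c d) e3 e4).
have N0 : 0 < `|u| + `|v| + 1 by rewrite ltr_pwDr // addr_ge0.
(* This size keeps the parallelogram with sides [h *: u] and [h *: v] in the ball of radius [r]; the
   [1] makes the denominator positive and the estimate strict. *)
pose h := r / (`|u| + `|v| + 1).
have h0 : 0 < h by rewrite divr_gt0.
have hr (s t : R) : 0 <= s <= 1 -> 0 <= t <= 1 ->
    ball z r (z + (s * h) *: u + (t * h) *: v).
  move=> /andP[s0 s1] /andP[t0 t1].
  rewrite -ball_normE /= -addrA opprD addNKr normrN.
  rewrite (le_lt_trans (ler_normD _ _)) // normrZ (normrZ (t * h)).
  rewrite !ger0_norm ?mulr_ge0 ?(ltW h0) ?(ltW r0) //.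
  have : h * (`|u| + `|v|) < r.
    by rewrite mulrAC ltr_pdivrMr // ltr_pM2l // ltrDl.
  apply: le_lt_trans; rewrite mulrDr.
  by apply: lerD; rewrite ler_wpM2r // ler_piMl // ltW.
have hr' (s t : R) : 0 <= s <= 1 -> 0 <= t <= 1 ->
    ball z r (z + (s * h) *: v + (t * h) *: u).
  by move=> s01 t01; rewrite addrAC; exact: hr.
have du (s t : R) s01 t01 := let: And4 d _ _ _ := rP _ (hr s t s01 t01) in d.
have dv (s t : R) s01 t01 := let: And4 _ d _ _ := rP _ (hr' s t s01 t01) in d.
have [s [t [s01 t01 E1]]] := second_difference du.
have [s' [t' [s01' t01' E2]]] := second_difference dv.
have [_ _ + _] := rP _ (hr _ _ s01 t01).
have [_ _ _ +] := rP _ (hr' _ _ s01' t01').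
(* Both sides are the same second difference, up to the order of its terms; [h] is then cancelled
   twice. *)
have : h * (h * 'D_v ('D_u f) (z + (s * h) *: u + (t * h) *: v)) =
    h * (h * 'D_u ('D_v f) (z + (s' * h) *: v + (t' * h) *: u)).
  apply: etrans (esym E1) _; apply: etrans _ E2.
  rewrite (addrAC z (h *: v)) !opprB addrACA [RHS]addrACA.
  by congr (_ + _); exact: addrC.
move=> /(mulfI (lt0r_neq0 h0)) /(mulfI (lt0r_neq0 h0)) ->.
rewrite add0r.
generalize ('D_v ('D_u f) z) ('D_u ('D_v f) z)
  ('D_u ('D_v f) (z + (s' * h) *: v + (t' * h) *: u)) => a b c bc ac.
rewrite (le_trans (ler_distD c a b)) // [X in X <= _]addrC ltW //.
by rewrite (splitr e) ltrD // distrC.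
Qed.

End MeanValue.

(** * Iterated partial derivatives and their reordering *)

Section SmoothFunctions.
Variables (R : realType) (n : nat).
Implicit Types (f g h : 'rV[R]_n -> R) (U : set 'rV[R]_n) (s : seq 'I_n).
Implicit Types (a : {ffun 'I_n -> nat}).

Lemma pderives_cat s1 s2 f :
  pderives (s1 ++ s2) f = pderives s1 (pderives s2 f).
Proof. exact: foldr_cat. Qed.

Lemma smooth_on_pderives U s f : smooth_on U f -> smooth_on U (pderives s f).
Proof. by move=> sf s' x Ux; rewrite -pderives_cat; exact: sf. Qed.

Lemma pderive_eq_on U i f g : open U -> (forall x, U x -> f x = g x) ->
  forall x, U x -> pderive i f x = pderive i g x.
Proof.
move=> oU fg x Ux; apply: near_eq_derive.
by apply: filterS (open_nbhs_nbhs (conj oU Ux)) => y; exact: fg.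
Qed.

Lemma pderive_swap U i j f x : open U -> smooth_on U f -> U x ->
  pderive i (pderive j f) x = pderive j (pderive i f) x.
Proof.
move=> oU sf Ux; have nU := open_nbhs_nbhs (conj oU Ux).
apply: derive_swap.
- by apply: filterS nU => y /(sf [::])[_]; exact.
- by apply: filterS nU => y /(sf [::])[_]; exact.
- by apply: filterS nU => y /(sf [:: j])[_]; exact.
- by apply: filterS nU => y /(sf [:: i])[_]; exact.
- by have [] := sf [:: i; j] x Ux.
- by have [] := sf [:: j; i] x Ux.
Qed.

(** Adjacent swaps bring any letter to the front ([front]), so induction can match the first letters
    of the two words. Openness of [U] allows equalities on [U] to be differentiated. *)
Lemma pderives_perm U s s' f : open U -> smooth_on U f -> perm_eq s s' ->
  forall x, U x -> pderives s f x = pderives s' f x.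
Proof.
move=> oU sf.
have front i s1 s2 : forall x, U x ->
    pderives (s1 ++ i :: s2) f x = pderives (i :: s1 ++ s2) f x.
  elim: s1 => [|j s1 IH] x Ux; first reflexivity.
  apply: etrans (pderive_eq_on j oU IH Ux) _.
  exact: (pderive_swap j i oU (smooth_on_pderives (s1 ++ s2) sf) Ux).
elim: s s' => [|i s IH] s' pss'.
  by move: pss'; rewrite perm_sym => /perm_nilP ->.
have /path.splitPr s'E : i \in s' by rewrite -(perm_mem pss') mem_head.
case: s'E pss' => s1 s2; rewrite perm_sym perm_catC /= perm_cons perm_catC.
rewrite perm_sym => /IH {}IH x Ux.
exact: etrans (pderive_eq_on i oU IH Ux) (esym (front i s1 s2 x Ux)).
Qed.

(** Spelling a multi-index as a word makes [mpderive] a special case of [pderives], on which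
    inductions run letter by letter. *)
Definition mexp_seq a : seq 'I_n := flatten [seq nseq (a i) i | i <- enum 'I_n].

Lemma mpderiveE a f : mpderive a f = pderives (mexp_seq a) f.
Proof.
rewrite /mpderive /mexp_seq; elim: (enum 'I_n) => //= i s ->.
rewrite pderives_cat; elim: (a i) => //= k IH.
by rewrite [in LHS]IH.
Qed.

Lemma count_mexp_seq a i : count_mem i (mexp_seq a) = a i.
Proof.
rewrite /mexp_seq count_flatten -map_comp sumnE big_map big_enum /=.
rewrite (bigD1 i) //= count_nseq /= eqxx mul1n big1 ?addn0 // => j ji.
by rewrite count_nseq /= (negbTE ji).
Qed.

Definition mincr (i : 'I_n) a : {ffun 'I_n -> nat} :=
  [ffun j => ((j == i) + a j)%N].

(** The words on the two sides have equal letter counts, hence are permutations of each other. *)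
Lemma mpderive_pderive U a i f : open U -> smooth_on U f ->
  forall x, U x -> mpderive a (pderive i f) x = mpderive (mincr i a) f x.
Proof.
move=> oU sf x Ux; rewrite !mpderiveE -[pderive i f]/(pderives [:: i] f).
rewrite -pderives_cat; apply: (pderives_perm oU) => //.
apply/allP => j _ /=; apply/eqP; rewrite count_cat !count_mexp_seq ffunE /=.
by rewrite addn0 addnC eq_sym.
Qed.

End SmoothFunctions.

(** * Dilations: chain rule and contraction of boxes *)

Section Dilations.
Variables (R : realType) (n : nat) (w : 'I_n -> nat).
Implicit Types (f g h : 'rV[R]_n -> R) (U V : set 'rV[R]_n) (s : seq 'I_n).
Implicit Types (x : 'rV[R]_n) (t : R).

(** Lines parallel to an axis stay parallel to it, so the chain rule reduces to rescaling the
    direction. *)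
Lemma dil_line t x (i : 'I_n) (k : R) :
  dil w t (k *: delta_mx 0 i + x) = k *: (t ^+ w i *: delta_mx 0 i) + dil w t x.
Proof.
apply/rowP => j; rewrite !mxE /= mulrDr; congr (_ + _).
by case: eqP => [->|_]; rewrite ?mulr0 // mulr1 mulr1 mulrC.
Qed.

Lemma dil0 t : dil w t 0 = 0 :> 'rV[R]_n.
Proof. by apply/rowP => j; rewrite !mxE mulr0. Qed.

Lemma is_derive_dil f t x (i : 'I_n) : derivable f (dil w t x) (delta_mx 0 i) ->
  is_derive x (delta_mx 0 i) (f \o dil w t)
    (t ^+ w i * pderive i f (dil w t x)).
Proof.
move=> /derivableP/(is_derive_dirZ (t ^+ w i))/is_derive_line df.
apply/is_derive_line; rewrite (_ : (fun _ => _) =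
  fun k : R => f (k *: (t ^+ w i *: delta_mx 0 i) + dil w t x)) //.
by apply/funext => k /=; rewrite dil_line.
Qed.

Lemma dil_continuous t x : {for x, continuous (dil w t)}.
Proof.
move=> P /nbhs_ballP[e /= e0 eP].
have : \forall y \near x, forall j : 'I_n,
    ball (t ^+ w j * x 0 j) e (t ^+ w j * (y : 'rV[R]_n) 0 j).
  apply: (@filter_forall _ _ _ (nbhs x) (nbhs_filter x)) => j.
  have := cvgMl_tmp (a := t ^+ w j) (@coord_continuous R 1 n 0 j x).
  by move=> /(_ (nbhs_filter x) _ (nbhsx_ballx (t ^+ w j * x 0 j) e e0)); exact.
apply: filterS => y xy; apply: eP; split => // i j; rewrite !mxE.
exact: xy.
Qed.

Lemma pderives_dil U V f t s : open V -> V `<=` dil w t @^-1` U ->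
  smooth_on U f -> forall x, V x ->
  pderives s (f \o dil w t) x =
    t ^+ (\sum_(i <- s) w i) * pderives s f (dil w t x).
Proof.
move=> oV VU sf; elim: s => [|i s IH] x Vx; first by rewrite big_nil mul1r.
apply: etrans (pderive_eq_on i oV IH Vx) _.
have [_ /(_ i) df] := sf s _ (VU _ Vx).
have [_] := is_deriveZ (t ^+ (\sum_(j <- s) w j)) (is_derive_dil df).
move=> /= E; apply: etrans E _.
by rewrite big_cons addnC exprD /GRing.scale /= mulrA.
Qed.

Lemma smooth_on_dil U V f t : open V -> V `<=` dil w t @^-1` U ->
  smooth_on U f -> smooth_on V (f \o dil w t).
Proof.
move=> oV VU sf s x Vx; have [cf df] := sf s _ (VU _ Vx).
pose c := t ^+ (\sum_(j <- s) w j).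
(* Continuity and derivability are transferred through this local equality. *)
have E : {near x, (c *: (pderives s f \o dil w t)) =1
    pderives s (f \o dil w t)}.
  apply: filterS (open_nbhs_nbhs (conj oV Vx)) => y Vy.
  by rewrite (pderives_dil s oV VU sf Vy).
split.
  apply: cvg_trans (near_eq_cvg E) _.
  have <- : (c *: (pderives s f \o dil w t)) x = pderives s (f \o dil w t) x.
    exact: nbhs_singleton E.
  apply: cvgZl_tmp; apply: continuous_comp cf; exact: dil_continuous.
move=> i; apply: near_eq_derivable E _.
by have [+ _] := is_deriveZ c (is_derive_dil (df i)).
Qed.

(** For [|t| <= 1] positive weights give [|t| ^+ w i <= |t|], so a box is contracted into any
    neighbourhood of the origin, uniformly in its points. *)
Lemma near_dil (P : set 'rV[R]_n) (B : R) :
  (forall i, 0 < w i)%N -> nbhs (0 : 'rV[R]_n) P ->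
  \forall t \near (0 : R), forall x, (forall i, `|x 0 i| <= B) -> P (dil w t x).
Proof.
move=> w0 /nbhs_ballP[e /= e0 eP].
(* [B] may be zero or negative; this larger bound can be divided by. *)
have B0 : 0 < `|B| + 1 by rewrite ltr_pwDr.
have : \forall t \near (0 : R), `|t| < Num.min 1 (e / (`|B| + 1)).
  apply/nbhs_ballP; exists (Num.min 1 (e / (`|B| + 1))) => /=.
    by rewrite lt_min ltr01 divr_gt0.
  by move=> t; rewrite -ball_normE /= sub0r normrN.
apply: filterS => t; rewrite lt_min ltr_pdivlMr // => /andP[t1 te] x xB.
apply: eP; split => // i j; rewrite ord1 !mxE -ball_normE /=.
rewrite sub0r normrN normrM.
apply: le_lt_trans te; rewrite normrX ler_pM //.
  by rewrite -[leRHS]expr1 ler_wiXn2l // ltW.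
by apply: le_trans (xB _) _; rewrite (le_trans (ler_norm _)) // lerDl.
Qed.

Lemma near_norm_le1 : \forall t \near (0 : R), `|t| <= 1.
Proof.
apply/nbhs_ballP; exists 1 => //= t; rewrite -ball_normE /= sub0r normrN.
exact: ltW.
Qed.

End Dilations.

(** * Homogeneous Taylor parts, their derivatives and their remainders *)

Section TaylorParts.
Variables (R : realType) (n : nat) (w : 'I_n -> nat).
Hypothesis w_gt0 : forall i, (0 < w i)%N.
Implicit Types (f g : 'rV[R]_n -> R) (U : set 'rV[R]_n) (x : 'rV[R]_n).
Implicit Types (a b : {ffun 'I_n -> nat}) (i : 'I_n) (t : R).

(** Positive weights force [a i <= l], so every such [a] comes from a function into ['I_l.+1]. *)
Lemma finite_wdeg (l : nat) : finite_set [set a | wdeg w a = l].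
Proof.
pose emb (b : {ffun 'I_n -> 'I_l.+1}) : {ffun 'I_n -> nat} :=
  [ffun i => b i : nat].
have : finite_set (emb @` [set: {ffun 'I_n -> 'I_l.+1}]).
  exact/finite_image/finite_finset.
apply: sub_finite_set => a /= al; exists [ffun i => inord (a i)] => //.
apply/ffunP => i; rewrite !ffunE inordK // ltnS -al /wdeg (bigD1 i) //=.
by rewrite (leq_trans _ (leq_addr _ _)) // leq_pmull.
Qed.

Lemma wdeg_mincr i a : wdeg w (mincr i a) = (w i + wdeg w a)%N.
Proof.
rewrite /wdeg (bigD1 i) //= ffunE eqxx mulnDr muln1 -addnA.
congr addn; rewrite [RHS](bigD1 i) //=; congr addn.
by apply: eq_bigr => j ji; rewrite ffunE (negbTE ji).
Qed.

Lemma mfact_mincr i a : mfact (mincr i a) = ((a i).+1 * mfact a)%N.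
Proof.
rewrite /mfact (bigD1 i) //= ffunE eqxx factS -mulnA.
congr muln; rewrite [RHS](bigD1 i) //=; congr muln.
by apply: eq_bigr => j ji; rewrite ffunE (negbTE ji).
Qed.

(** The partial derivative of [monom a]; when [a i = 0] the leading factor makes the truncated
    exponent harmless. *)
Definition dmonom i a x : R :=
  (a i)%:R * (x 0 i ^+ (a i).-1 * \prod_(j | j != i) x 0 j ^+ a j).

Lemma dmonom_mincr i a x : dmonom i (mincr i a) x = (a i).+1%:R * monom a x.
Proof.
rewrite /dmonom ffunE eqxx /= /monom [in RHS](bigD1 i) //=.
congr (_ * (_ * _)).
by apply: eq_bigr => j ji; rewrite ffunE (negbTE ji).
Qed.

Lemma is_derive_monom i a x :
  is_derive x (delta_mx 0 i) (monom a) (dmonom i a x).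
Proof.
apply/is_derive_line.
pose c := \prod_(j | j != i) x 0 j ^+ a j.
rewrite (_ : (fun _ => _) = c *: ((id + cst (x 0 i)) ^+ a i : R -> R)).
  apply: is_derive_eq; rewrite /dmonom -/c.
  rewrite /GRing.scale /= !fctE add0r addr0 mulr1.
  by rewrite mulrC -mulrA.
rewrite funeqE => k; transitivity (c * (k + x 0 i) ^+ a i); last first.
  by rewrite exprfctE.
rewrite /monom (bigD1 i) //= mulrC !mxE /= !eqxx mulr1; congr (_ * _).
by apply: eq_bigr => j ji; rewrite !mxE (negbTE ji) mulr0 add0r.
Qed.

Lemma is_derive_fsum (V : normedModType R) (I : choiceType) (A : set I)
    (F : I -> V -> R) (dF : I -> R) (z v : V) :
  finite_set A -> (forall k, is_derive z v (F k) (dF k)) ->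
  is_derive z v (fun y => \sum_(k \in A) F k y) (\sum_(k \in A) dF k).
Proof.
move=> finA dFE; rewrite fsbig_finite //.
under eq_fun do rewrite fsbig_finite //.
elim: (finmap.enum_fset _) => [|k s IH].
  rewrite big_nil; under eq_fun do rewrite big_nil.
  exact: is_derive_cst.
rewrite big_cons; under eq_fun do rewrite big_cons.
exact: is_deriveD.
Qed.

(** Only multi-indices with [a i > 0] survive differentiation. They are the [mincr i b] with [b] of
    weighted degree [l - w i], and the exponent brought down cancels against the factorial. *)
Lemma is_derive_taylor_part U f i l x : open U -> U 0 -> smooth_on U f ->
  is_derive x (delta_mx 0 i) (taylor_part w f l)
    (if (w i <= l)%N then taylor_part w (pderive i f) (l - w i) x else 0).
Proof.
move=> oU U0 sf.
pose c a : R := (mfact a)%:R^-1 * mpderive a f 0.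
have := @is_derive_fsum _ _ _ (fun a y => c a * monom a y)
  (fun a => c a * dmonom i a x) x (delta_mx 0 i) (finite_wdeg l)
  (fun a => is_deriveZ (c a) (is_derive_monom i a x)).
move/is_derive_eq; apply.
have pos a : c a * dmonom i a x != 0 -> (0 < a i)%N.
  by rewrite lt0n; apply: contra => /eqP E; rewrite /dmonom E mul0r mulr0.
case: leqP => [wl|lw]; last first.
  (* A term with [a i > 0] has weighted degree at least [w i > l], so none survives. *)
  apply: fsbig1 => a al; apply: contraPeq al => /pos ai /=; apply/eqP.
  rewrite neq_ltn orbC (leq_trans lw) // /wdeg (bigD1 i) //=.
  by rewrite (leq_trans _ (leq_addr _ _)) // leq_pmulr.
rewrite -(fsbig_widen [set a | wdeg w a = l /\ (0 < a i)%N]).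
- rewrite (reindex_fsbig (mincr i) [set a | wdeg w a = (l - w i)%N]).
    apply: eq_fsbigr => a _; rewrite dmonom_mincr mulrA; congr (_ * _).
    rewrite /c (mpderive_pderive a i oU sf U0) mulrAC; congr (_ * _).
    rewrite mfact_mincr natrM invfM mulrAC mulVf ?mul1r //.
  split.
  + move=> a /= al; rewrite wdeg_mincr al subnKC //; split=> //.
    by rewrite ffunE eqxx.
  + move=> a b _ _ /ffunP ab; apply/ffunP => j; have := ab j.
    by rewrite !ffunE => /addnI.
  + move=> a [al ai].
    (* Lowering the exponent at [i] inverts [mincr i], because [a i] is positive. *)
    have aE : mincr i [ffun j => (a j - (j == i))%N] = a.
      apply/ffunP => j; rewrite !ffunE.
      by case: eqP => [->|_]; rewrite ?subn0 // subnKC.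
    exists [ffun j => (a j - (j == i))%N].
      by apply/(@addnI (w i)); rewrite -wdeg_mincr subnKC // -al aE.
    exact: aE.
- by move=> a [].
- move=> a [/= al] /not_andP[//|] ai; apply: contrapT => /eqP /pos.
  exact: ai.
Qed.

Definition taylor_rem f (M : nat) t x : R :=
  f (dil w t x) - \sum_(l < M) t ^+ l * taylor_part w f l x.

Lemma is_derive_taylor_rem U f i M t x : open U -> U 0 -> smooth_on U f ->
  U (dil w t x) -> is_derive x (delta_mx 0 i) (taylor_rem f M t)
    (t ^+ w i * taylor_rem (pderive i f) (M - w i) t x).
Proof.
move=> oU U0 sf Ux.
have [_ /(_ i) df] := sf [::] _ Ux.
pose dT l := if (w i <= l)%N
  then taylor_part w (pderive i f) (l - w i) x else 0.
have dT' (l : 'I_M) := is_deriveZ (t ^+ l)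
  (is_derive_taylor_part i l x oU U0 sf).
have := is_deriveB (is_derive_dil df) (is_derive_sum dT').
rewrite (_ : _ - _ = taylor_rem f M t); last first.
  by apply/funext => y; rewrite /taylor_rem !fctE fct_sumE.
move/is_derive_eq; apply.
rewrite /taylor_rem mulrBr; congr (_ - _).
rewrite /GRing.scale /= mulr_sumr.
have [wM|Mw] := leqP (w i) M; last first.
  (* Here every [l < M] is below [w i], so all derivatives vanish, and truncated subtraction empties
     the other sum. *)
  rewrite (eqP (ltnW Mw)) big_ord0 big1 // => l _.
  by rewrite leqNgt (ltn_trans _ Mw) // mulr0.
(* The terms with [l < w i] vanish; the others are reindexed by [l - w i]. *)
rewrite -(big_mkord xpredT (fun l => t ^+ l * dT l)) (big_cat_nat _ wM) //=.
rewrite big_nat big1 ?add0r; last first.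
  by move=> l /= lw; rewrite /dT leqNgt lw mulr0.
rewrite -{1}[w i]add0n big_addn big_mkord; apply: eq_bigr => l _.
by rewrite /dT leq_addl addnK addnC exprD mulrA.
Qed.

(** The formula holds on the open set [V], so it can be differentiated again; the truncated
    subtractions compose. *)
Lemma pderives_taylor_rem U V f s M t : open U -> U 0 -> smooth_on U f ->
  open V -> V `<=` dil w t @^-1` U -> forall x, V x ->
  pderives s (taylor_rem f M t) x = t ^+ (\sum_(i <- s) w i) *
    taylor_rem (pderives s f) (M - \sum_(i <- s) w i) t x.
Proof.
move=> oU U0 sf oV VU; elim: s => [|i s IH] x Vx.
  by rewrite big_nil mul1r subn0.
apply: etrans (pderive_eq_on i oV IH Vx) _.
have [_] := is_deriveZ (t ^+ (\sum_(j <- s) w j)) (is_derive_taylor_rem i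
  (M - \sum_(j <- s) w j) oU U0 (smooth_on_pderives s sf) (VU _ Vx)).
move=> /= E; apply: etrans E _.
by rewrite big_cons addnC exprD /GRing.scale /= mulrA subnDA.
Qed.

Lemma mexp_seq0 : mexp_seq [ffun=> 0%N] = [::] :> seq 'I_n.
Proof.
by rewrite /mexp_seq; elim: (enum 'I_n) => //= i s ->; rewrite ffunE.
Qed.

(** Positivity of the weights leaves zero as the only multi-index of weighted degree 0. *)
Lemma taylor_part0 f : taylor_part w f 0 0 = f 0.
Proof.
rewrite /taylor_part (_ : [set a | _] = [set [ffun=> 0%N]]).
  rewrite fsbig_set1 mpderiveE mexp_seq0 /mfact /monom /= !big1.
  - by rewrite invr1 mul1r mulr1.
  - by move=> i _; rewrite ffunE expr0.
  - by move=> i _; rewrite ffunE fact0.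
apply/seteqP; split => a /=; last first.
  by move=> ->; rewrite /wdeg big1 // => i _; rewrite ffunE muln0.
move/eqP; rewrite sum_nat_eq0 => /forallP /= a0; apply/ffunP => i.
by have := a0 i; rewrite ffunE muln_eq0 eqn0Ngt w_gt0 => /eqP.
Qed.

Lemma taylor_part_at0 f l : (0 < l)%N -> taylor_part w f l 0 = 0.
Proof.
move=> l0; apply: fsbig1 => a /= al; rewrite /monom.
have [i ai] : exists i, (0 < a i)%N.
  apply/existsP; rewrite -[X in is_true X]negbK negb_exists.
  apply/negP => /forallP a0.
  move: l0; rewrite -al /wdeg big1 // => i _; have := a0 i.
  by rewrite -eqn0Ngt => /eqP ->; rewrite muln0.
by rewrite (bigD1 i) //= mxE expr0n gtn_eqF // mul0r mulr0.
Qed.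

Lemma taylor_rem_at0 f M t : (0 < M)%N -> taylor_rem f M t 0 = 0.
Proof.
case: M => // M _; rewrite /taylor_rem dil0 big_ord_recl expr0 mul1r.
rewrite taylor_part0 big1 ?addr0 ?subrr // => i _.
by rewrite taylor_part_at0 ?mulr0.
Qed.

End TaylorParts.

(** * Uniform bounds for the remainders on boxes *)

Section RemainderBound.
Variables (R : realType) (n : nat).
Implicit Types (f g h : 'rV[R]_n -> R) (U : set 'rV[R]_n) (x : 'rV[R]_n).
Implicit Types (t B D : R).

(** The coordinates of [x] are switched on one at a time; each of the [n] moves stays in the box
    and, by the mean value theorem, changes [h] by at most [D * B]. *)
Lemma box_increment_le h B D x : 0 <= D ->
  (forall (y : 'rV[R]_n) (i : 'I_n), (forall j, `|y 0 j| <= B) ->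
     derivable h y (delta_mx 0 i) /\ `|pderive i h y| <= D) ->
  (forall j, `|x 0 j| <= B) -> `|h x - h 0| <= n%:R * (D * B).
Proof.
move=> D0 hD xB; pose y k : 'rV[R]_n := \row_j (if (j < k)%N then x 0 j else 0).
have y0 : y 0%N = 0 by apply/rowP => j; rewrite !mxE.
have yn : y n = x by apply/rowP => j; rewrite !mxE ltn_ord.
have step (i : 'I_n) : `|h (y i.+1) - h (y i)| <= D * B.
  have -> : y i.+1 = y i + x 0 i *: delta_mx 0 i.
    apply/rowP => j; rewrite !mxE /= ltnS -val_eqE /=.
    by case: ltngtP => [||/val_inj ->]; rewrite ?mulr0 ?addr0 ?mulr1 ?add0r.
  have dy (s : R) : 0 <= s <= 1 -> forall j,
      `|(y i + (s * x 0 i) *: delta_mx 0 i) 0 j| <= B.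
    move=> /andP[s0 s1] j; rewrite !mxE /= -val_eqE /=.
    have B0 := le_trans (normr_ge0 _) (xB j).
    case: ltngtP => _; rewrite ?mulr0 ?addr0 ?mulr1 ?add0r ?normr0 //.
    rewrite normrM ger0_norm //; apply: le_trans (xB i).
    by rewrite ler_piMl.
  have [s s01|s s01 ->] := @MVT_lineZ _ _ h (y i) (delta_mx 0 i) (x 0 i).
    exact: (hD _ i (dy s s01)).1.
  have [_ dD] := hD _ i (dy s s01).
  by rewrite normrM mulrC ler_pM.
have : forall k, (k <= n)%N -> `|h (y k) - h 0| <= k%:R * (D * B).
  elim=> [|k IH] kn; first by rewrite y0 subrr normr0 mul0r.
  rewrite (le_trans (ler_distD (h (y k)) _ _)) // mulrSr mulrDl mul1r addrC.
  by rewrite lerD ?IH ?(ltnW kn) //; exact: (step (Ordinal kn)).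
by move=> /(_ n (leqnn n)); rewrite yn.
Qed.

Variable w : 'I_n -> nat.
Hypothesis w_gt0 : forall i, (0 < w i)%N.

(** For [k > M] the truncated difference is 0 and the exponent on the left exceeds [M]; this is
    where [|t| <= 1] enters. *)
Lemma exp_sub_bound t C (k M : nat) : `|t| <= 1 -> 0 <= C ->
  `|t| ^+ k * (C * `|t| ^+ (M - k)) <= C * `|t| ^+ M.
Proof.
move=> t1 C0; rewrite mulrCA ler_wpM2l // -exprD ler_wiXn2l //.
by rewrite -leq_subLR.
Qed.

Lemma taylor_rem_bound U (M : nat) f B : open U -> U 0 -> smooth_on U f ->
  exists2 C : R, 0 <= C & \forall t \near (0 : R),
    forall x, (forall i, `|x 0 i| <= B) ->
    `|taylor_rem w f M t x| <= C * `|t| ^+ M.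
Proof.
move=> oU U0; elim/ltn_ind: M f => -[|M] IH f sf.
  (* For [M = 0] the remainder is [f (dil w t x)], which continuity of [f] at the origin bounds. *)
  exists (`|f 0| + 1); first by rewrite addr_ge0.
  have [cf _] := sf [::] 0 U0.
  have nf : nbhs (0 : 'rV[R]_n) [set y | `|f y| <= `|f 0| + 1].
    move/cvgrPdist_lt: cf => /(_ 1 ltr01); apply: filterS => y /= fy.
    rewrite -lerBlDl (le_trans (lerB_dist _ _)) // distrC ltW //.
  apply: filterS (near_dil B w_gt0 nf) => t tP x xB.
  rewrite /taylor_rem big_ord0 subr0 expr0 mulr1; exact: tP.
have /choice[C CP] : forall i : 'I_n, exists C : R, 0 <= C /\
    \forall t \near (0 : R), forall x, (forall i, `|x 0 i| <= B) ->
    `|taylor_rem w (pderive i f) (M.+1 - w i) t x| <= C * `|t| ^+ (M.+1 - w i).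
  move=> i; have [||C C0 CP] := IH (M.+1 - w i)%N _ (pderive i f).
  (* A positive weight makes the order drop strictly, as strong induction requires. *)
  - by rewrite ltn_subrL w_gt0.
  - exact: (smooth_on_pderives [:: i] sf).
  by exists C.
have C0 i : 0 <= C i by have [] := CP i.
pose D := \sum_i C i; have D0 : 0 <= D by rewrite sumr_ge0.
(* The factor [B] of the box estimate is replaced by its absolute value to keep the constant
   nonnegative. *)
exists (n%:R * (D * `|B|)); first by rewrite !mulr_ge0.
(* There are finitely many [i], so one neighbourhood of [t = 0] serves them all. *)
have nC : \forall t \near (0 : R), forall i x, (forall i, `|x 0 i| <= B) ->
    `|taylor_rem w (pderive i f) (M.+1 - w i) t x| <=
      C i * `|t| ^+ (M.+1 - w i).
  apply: (@filter_forall _ _ _ (nbhs (0 : R)) (nbhs_filter _)) => i.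
  by have [] := CP i.
have nU := near_dil B w_gt0 (open_nbhs_nbhs (conj oU U0)).
apply: filterS (filterI (filterI nC nU) (near_norm_le1 R)) => t.
move=> [[tC tU] t1] x xB.
have := @box_increment_le (taylor_rem w f M.+1 t) B (D * `|t| ^+ M.+1) x.
rewrite taylor_rem_at0 // subr0 => H; apply: le_trans (H _ _ xB) _.
- by rewrite mulr_ge0.
- move=> y i yB.
  have [dr rE] := is_derive_taylor_rem w_gt0 i M.+1 oU U0 sf (tU _ yB).
  split; first exact: dr.
  rewrite /pderive rE normrM normrX.
  apply: (@le_trans _ _ (`|t| ^+ w i * (C i * `|t| ^+ (M.+1 - w i)))).
    by rewrite ler_wpM2l // tC.
  rewrite (le_trans (exp_sub_bound _ _ t1 (C0 i))) // ler_wpM2r //.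
  by rewrite /D (bigD1 i) //= lerDl sumr_ge0.
- rewrite -!mulrA ler_wpM2l // ler_wpM2l // mulrC ler_wpM2r //.
  exact: ler_norm.
Qed.

End RemainderBound.

(** * Homogeneity and polynomiality of the Taylor parts *)

Section HomogeneousPolynomial.
Import -(notations) mpoly.
Variables (R : realType) (n : nat) (w : 'I_n -> nat).
Hypothesis w_gt0 : forall i, (0 < w i)%N.
Implicit Types (f : 'rV[R]_n -> R).

(** A dilation multiplies each [monom a] by the product of the [t ^+ (w i * a i)], that is by
    [t ^+ wdeg w a]. *)
Lemma taylor_part_homogeneous f l : homogeneous w l (taylor_part w f l).
Proof.
move=> t x; rewrite /taylor_part mulr_fsumr; apply: eq_fsbigr => a.
rewrite inE /= => <-; rewrite mulrCA; congr (_ * _).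
rewrite /monom /wdeg -prodrXr -big_split /=; apply: eq_bigr => i _.
by rewrite mxE exprMn exprM.
Qed.

Lemma taylor_part_polynomial f l : polynomial_fun (taylor_part w f l).
Proof.
pose c a : R := (mfact a)%:R^-1 * mpderive a f 0.
exists (\sum_(a <- finmap.enum_fset (fset_set [set a | wdeg w a = l]))
  mpolyC n (c a) * \prod_i mpolyX R (mnm1 i) ^+ a i).
move=> x; rewrite /taylor_part fsbig_finite; last exact: finite_wdeg.
rewrite raddf_sum /=; apply: eq_bigr => a _.
rewrite mevalM mevalC; congr (_ * _).
rewrite rmorph_prod; apply: eq_bigr => i _.
by rewrite rmorphXn /= mevalXU.
Qed.

End HomogeneousPolynomial.

Unset Implicit Arguments.

Theorem proposition4p13 (R : realType) (n r : nat) (w : 'I_n -> nat)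
    (w_bound : forall i : 'I_n, (1 <= w i <= r)%N)
    (w_ndecr : forall i j : 'I_n, (i <= j)%N -> (w i <= w j)%N)
    (U : set 'rV[R]_n) (U_open : open U) (U0 : U 0)
    (f : 'rV[R]_n -> R) (f_smooth : smooth_on U f) :
  smooth_asymptotic U (fun t => dil w t @^-1` U) (fun t => f \o dil w t)
    (taylor_part w f) /\
  forall l : nat,
    polynomial_fun (taylor_part w f l) /\ homogeneous w l (taylor_part w f l).
Proof.
have w_gt0 i : (0 < w i)%N by have /andP[] := w_bound i.
split; last first.
  move=> l; split; first exact: taylor_part_polynomial.
  exact: taylor_part_homogeneous.
move=> N K a cK KU; rewrite /seminorm.
have [B KB] : exists B : R, K `<=` ball (0 : 'rV[R]_n) B.
  (* Every number above [M] bounds the norm on [K]; [M + 1] is one, and [M + 2] gives the strict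
     inequality of an open ball. *)
  have [M [Mr MK]] := compact_bounded cK; exists (M + 2) => x Kx.
  rewrite -ball_normE /= sub0r normrN (le_lt_trans (MK (M + 1) _ _ Kx)) //.
    by rewrite ltrDl.
  by rewrite ltrD2l ltr1n.
(* This ball is both the neighbourhood of [K] where the dilated function is smooth and the open set
   for the derivative formula; in the sup norm it lies in the box of size [B]. *)
pose V := ball (0 : 'rV[R]_n) B.
have VB (x : 'rV[R]_n) : V x -> forall i, `|x 0 i| <= B.
  case=> _ xB i; have := xB 0 i; rewrite mxE -ball_normE /=.
  by rewrite sub0r normrN => /ltW.
(* The differentiated function only gets a remainder of this lower order; the factor
   [t ^+ \sum_(i <- mexp_seq a) w i] from the chain rule restores [N]. *)
have [C C0 CP] := taylor_rem_bound w_gt0 (N - \sum_(i <- mexp_seq a) w i) B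
  U_open U0 (smooth_on_pderives (mexp_seq a) f_smooth).
exists C.
have nU := near_dil B w_gt0 (open_nbhs_nbhs (conj U_open U0)).
apply: filterS (filterI (filterI CP nU) (near_norm_le1 R)) => t [[tC tU] t1].
have oV : open V by exact: ball_open.
have VU : V `<=` dil w t @^-1` U by move=> x /VB/tU.
split.
  by exists V; split=> //; exact: (smooth_on_dil oV VU f_smooth).
apply: ge_ereal_sup => _ [x Kx <-]; rewrite lee_fin mpderiveE.
have -> := pderives_taylor_rem w_gt0 (mexp_seq a) N U_open U0 f_smooth
  oV VU (KB _ Kx).
rewrite normrM !normrX.
apply: le_trans (exp_sub_bound (\sum_(i <- mexp_seq a) w i) N t1 C0).
by rewrite ler_wpM2l //; exact/tC/VB/KB.
Qed.
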